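(* Let $P$ be a countable Köthe set on a set $I$ such that $A=\lambda(P)$ is a Köthe algebra. Suppose that $P\sim P^2$ and that for every $p\in P$ there exist $q\in P$ and $\alpha\in\ell^1(I)$ such that $p_i\le\alpha_i q_i$ for all $i\in I$. Then $A$ is approximately contractible.
   Context: A Köthe set on a set $I$ is a set $P$ of functions $p=(p_i)_{i\in I}\colon I\to[0,\infty)$ such that (P1) for every $i\in I$ there is $p\in P$ with $p_i>0$; (P2) for all $p,q\in P$ there is $r\in P$ with $\max\{p_i,q_i\}\le r_i$ for all $i\in I$. All Köthe sets $P$ are assumed countable. The Köthe space is $\lambda(P)=\{x=(x_i)\in\mathbb{C}^I:\ \|x\|_p=\sum_{i}|x_i|p_i<\infty\ \ \forall p\in P\}$, a Fréchet space under the seminorms $\|\cdot\|_p$, $p\in P$. For Köthe sets $P,Q$ on $I$, $P\prec Q$ means that for each $p\in P$ there are $q\in Q$ and $C>0$ with $p_i\le Cq_i$ for all $i\in I$; $P\sim Q$ means $P\prec Q$ and $Q\prec P$. $P^2=\{pq=(p_iq_i)_{i\in I}: p,q\in P\}$. $\lambda(P)$ is called a Köthe algebra if $P\prec P^2$; it is then a subalgebra of $\mathbb{C}^I$ (with pointwise multiplication) and a Fréchet algebra. A Fréchet algebra is a complete metrizable locally convex algebra over $\mathbb{C}$ with jointly continuous multiplication (associative, not necessarily unital, not necessarily locally $m$-convex). A Fréchet $A$-bimodule is an $A$-bimodule $X$ which is a Fréchet space such that both actions $A\times X\to X$ and $X\times A\to X$ are continuous. A derivation $D\colon A\to X$ is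 a linear map with $D(ab)=a\cdot D(b)+D(a)\cdot b$; it is inner if it has the form $a\mapsto a\cdot x-x\cdot a$ for some $x\in X$. A Fréchet algebra $A$ is approximately contractible if for each Fréchet $A$-bimodule $X$ every continuous derivation $D\colon A\to X$ is the limit of a pointwise convergent net of inner derivations, i.e. there is a net $(D_\nu)$ of inner derivations $A\to X$ with $D_\nu(a)\to D(a)$ in $X$ for every $a\in A$. *)

(* Defs.v *)
From HB Require Import structures.
From mathcomp Require Import all_boot all_order all_algebra.
From mathcomp Require Import complex.
From mathcomp Require Import all_classical all_reals all_analysis.

Set Implicit Arguments.
Unset Strict Implicit.
Unset Printing Implicit Defensive.

Import Order.TTheory GRing.Theory Num.Theory.
Import numFieldNormedType.Exports.

Local Open Scope classical_set_scope.
Local Open Scope ring_scope.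
Local Open Scope complex_scope.

Import ComplexField.Normc.

Section FrechetSpaces.
Variable R : realType.

Definition metrizable (T : topologicalType) :=
  exists d : T -> T -> R,
    [/\ forall x y, d x y = 0 <-> x = y,
        forall x y, d x y = d y x,
        forall x y z, d x z <= d x y + d y z &
        forall (x : T) (U : set T),
          nbhs x U <-> exists2 e : R, 0 < e & [set y | d x y < e] `<=` U].

(* The uniform structure carried by a [tvsType] is only required to induce the
   topology, so completeness is expressed with the Cauchy filters of the
   additive group, not with [entourage]. *)
Definition tvs_complete (X : tvsType R[i]) :=
  forall F : set_system X, ProperFilter F ->
    (xy.1 - xy.2) @[xy --> (F, F)] --> (0 : X) ->
    exists l : X, F --> l.

Definition frechet_space (X : tvsType R[i]) := metrizable X /\ tvs_complete X.

(* Not necessarily unital, whence a bare multiplication and not a ring. *)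
Record frechetAlgebra := FrechetAlgebra {
  fa_sort :> tvsType R[i];
  fa_frechet : frechet_space fa_sort;
  fa_mul : fa_sort -> fa_sort -> fa_sort;
  fa_mulA : associative fa_mul;
  fa_mul_linearl : forall b, linear (fa_mul^~ b);
  fa_mul_linearr : forall a, linear (fa_mul a);
  fa_mul_continuous :
    continuous (fun ab : fa_sort * fa_sort => fa_mul ab.1 ab.2)
}.

Record frechetBimodule (A : frechetAlgebra) := FrechetBimodule {
  fb_sort :> tvsType R[i];
  fb_frechet : frechet_space fb_sort;
  fb_lact : A -> fb_sort -> fb_sort;
  fb_ract : fb_sort -> A -> fb_sort;
  fb_lact_linearl : forall x, linear (fb_lact^~ x);
  fb_lact_linearr : forall a, linear (fb_lact a);
  fb_ract_linearl : forall a, linear (fb_ract^~ a);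
  fb_ract_linearr : forall x, linear (fb_ract x);
  fb_lactA : forall a b x, fb_lact (fa_mul a b) x = fb_lact a (fb_lact b x);
  fb_ractA : forall x a b, fb_ract x (fa_mul a b) = fb_ract (fb_ract x a) b;
  fb_lractA : forall a x b, fb_ract (fb_lact a x) b = fb_lact a (fb_ract x b);
  fb_lact_continuous : continuous (fun ax : A * fb_sort => fb_lact ax.1 ax.2);
  fb_ract_continuous : continuous (fun xa : fb_sort * A => fb_ract xa.1 xa.2)
}.

Definition derivation (A : frechetAlgebra) (X : frechetBimodule A)
    (D : A -> X) :=
  linear D /\
  forall a b, D (fa_mul a b) = fb_lact a (D b) + fb_ract (D a) b.

Definition inner_derivation (A : frechetAlgebra) (X : frechetBimodule A)
    (D : A -> X) :=
  exists x : X, forall a, D a = fb_lact a x - fb_ract x a.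

Definition directed (N : Type) (le : N -> N -> Prop) :=
  [/\ inhabited N, forall n, le n n,
      forall l m n, le l m -> le m n -> le l n &
      forall m n, exists k, le m k /\ le n k].

(* Convergence of a net indexed by (N, le) is convergence along [tails le]. *)
Definition tails (N : Type) (le : N -> N -> Prop) : set_system N :=
  [set S | exists n0, forall n, le n0 n -> S n].

Definition approximately_contractible (A : frechetAlgebra) :=
  forall (X : frechetBimodule A) (D : A -> X), derivation D -> continuous D ->
    exists (N : Type) (le : N -> N -> Prop) (Dn : N -> A -> X),
      [/\ directed le, forall n, inner_derivation (Dn n) &
          forall a, Dn n a @[n --> tails le] --> D a].

End FrechetSpaces.

Section KotheSets.
Variables (R : realType) (I : Type).

Record kotheSet := KotheSet {
  weights :> set (I -> R);
  kothe_ge0 : forall p, weights p -> forall i, 0 <= p i;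
  kothe_gt0 : forall i, exists2 p, weights p & 0 < p i;
  kothe_max : forall p q, weights p -> weights q ->
    exists2 r, weights r & forall i, Num.max (p i) (q i) <= r i;
  kothe_countable : countable weights
}.

Definition kothe_prec (P Q : set (I -> R)) :=
  forall p, P p -> exists q (C : R), [/\ Q q, 0 < C & forall i, p i <= C * q i].

Definition kothe_equiv (P Q : set (I -> R)) :=
  kothe_prec P Q /\ kothe_prec Q P.

Definition kothe_sq (P : set (I -> R)) : set (I -> R) :=
  [set p \* q | p in P & q in P].

End KotheSets.

Section KotheSpace.
Variables (R : realType) (I : choiceType) (P : kotheSet R I).

(* Unordered sum of nonnegative terms; [normc] is the modulus with values in R. *)
Definition kothe_esum (p : I -> R) (x : I -> R[i]) : \bar R :=
  \esum_(i in [set: I]) (normc (x i) * p i)%:E.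

Definition in_kothe : {pred I -> R[i]^o} :=
  fun x => `[< forall p, weights P p -> (kothe_esum p x < +oo)%E >].

Record kothe_space := KotheSpace {
  kothe_fun :> I -> R[i]^o;
  _ : kothe_fun \in in_kothe
}.

HB.instance Definition _ := [isSub of kothe_space for kothe_fun].
HB.instance Definition _ := [Choice of kothe_space by <:].

Lemma normc_ge0 (z : R[i]) : 0 <= normc z.
Proof. by case: z => a b; exact: sqrtr_ge0. Qed.

Let term_ge0 (p : I -> R) (x : I -> R[i]) i :
  weights P p -> (0 <= (normc (x i) * p i)%:E)%E.
Proof. by move=> Pp; rewrite lee_fin mulr_ge0 ?normc_ge0 ?(kothe_ge0 Pp). Qed.

Lemma kothe_esum_ge0 p x : weights P p -> (0 <= kothe_esum p x)%E.
Proof. by move=> Pp; apply: esum_ge0 => i _; exact: term_ge0. Qed.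

Lemma kothe_esumD p (x y : I -> R[i]^o) : weights P p ->
  (kothe_esum p (x + y)%R <= kothe_esum p x + kothe_esum p y)%E.
Proof.
move=> Pp; rewrite -esumD; [|by move=> i _; exact: term_ge0..].
apply: le_esum => i _; rewrite -EFinD lee_fin -mulrDl ler_wpM2r//.
  exact: kothe_ge0 Pp i.
exact: le_normcD.
Qed.

Lemma esumZl_le (f : I -> \bar R) (c : R) : 0 <= c -> (forall i, 0 <= f i)%E ->
  (\esum_(i in [set: I]) (c%:E * f i) <= c%:E * \esum_(i in [set: I]) f i)%E.
Proof.
move=> c0 f0; apply: ge_ereal_sup => _ [X XI <-].
rewrite -ge0_mule_fsumr//; apply: lee_wpmul2l => //.
by apply: esum_ge; exists X.
Qed.

Lemma kothe_esumZ p c (x : I -> R[i]^o) : weights P p ->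
  (kothe_esum p (c *: x)%R <= (normc c)%:E * kothe_esum p x)%E.
Proof.
move=> Pp; apply: le_trans (esumZl_le _ _); last 2 first.
- exact: normc_ge0.
- by move=> i; exact: term_ge0.
apply: le_esum => i _; rewrite -EFinM lee_fin mulrA.
by rewrite -normcM.
Qed.

Lemma in_kotheP (x : I -> R[i]^o) :
  reflect (forall p, weights P p -> (kothe_esum p x < +oo)%E) (x \in in_kothe).
Proof. exact: asboolP. Qed.

Lemma kothe_esum0 p : kothe_esum p (0 : I -> R[i]^o) = 0%E.
Proof. by apply: esum1 => i _; rewrite [normc _](normc0 R) mul0r. Qed.

Lemma in_kothe_submod_closed : submod_closed in_kothe.
Proof.
split=> [|c x y /in_kotheP xP /in_kotheP yP]; apply/in_kotheP => p Pp.
  by rewrite kothe_esum0.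
apply: le_lt_trans (kothe_esumD _ _ Pp) _.
apply: lte_add_pinfty; last exact: yP.
apply: le_lt_trans (kothe_esumZ _ _ Pp) _.
by apply: lte_mul_pinfty; [rewrite lee_fin normc_ge0| |exact: xP].
Qed.

HB.instance Definition _ := GRing.isSubmodClosed.Build R[i] (I -> R[i]^o)
  in_kothe in_kothe_submod_closed.
HB.instance Definition _ := [SubChoice_isSubLmodule of kothe_space by <:].

Definition kothe_norm (p : I -> R) (x : kothe_space) : R :=
  fine (kothe_esum p x).

Lemma kothe_normE p x : weights P p -> (kothe_norm p x)%:E = kothe_esum p x.
Proof.
move=> Pp; rewrite fineK// ge0_fin_numE ?kothe_esum_ge0//.
by case: x => x /= /in_kotheP; exact.
Qed.

Lemma kothe_norm_ge0 p x : weights P p -> 0 <= kothe_norm p x.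
Proof. by move=> Pp; rewrite -lee_fin kothe_normE// kothe_esum_ge0. Qed.

Lemma kothe_norm0 p : kothe_norm p 0 = 0.
Proof. by rewrite /kothe_norm kothe_esum0. Qed.

Lemma kothe_normD p x y : weights P p ->
  kothe_norm p (x + y) <= kothe_norm p x + kothe_norm p y.
Proof.
by move=> Pp; rewrite -lee_fin EFinD !kothe_normE//; exact: kothe_esumD.
Qed.

Lemma kothe_normZ p c x : weights P p ->
  kothe_norm p (c *: x) <= normc c * kothe_norm p x.
Proof.
by move=> Pp; rewrite -lee_fin EFinM !kothe_normE//; exact: kothe_esumZ.
Qed.

Lemma kothe_normN p x : weights P p -> kothe_norm p (- x) = kothe_norm p x.
Proof.
move=> Pp; rewrite /kothe_norm /kothe_esum; congr fine; apply: eq_esum => i _.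
by rewrite -(normcN (x i)).
Qed.

Lemma kothe_coord p (x : kothe_space) i : weights P p ->
  normc (x i) * p i <= kothe_norm p x.
Proof.
move=> Pp; rewrite -lee_fin kothe_normE//; apply: esum_ge.
by exists [set i]; [split|rewrite fsbig_set1].
Qed.

(* The topology generated by the seminorms [kothe_norm p], p in P. *)
Definition kothe_ball (S : set (I -> R)) (e : R) (x : kothe_space) :
    set kothe_space :=
  [set y | forall p, S p -> kothe_norm p (y - x) < e].

Definition kothe_nbhs (x : kothe_space) : set_system kothe_space :=
  [set U | exists S (e : R), [/\ finite_set S, S `<=` weights P, 0 < e &
                           kothe_ball S e x `<=` U]].

HB.instance Definition _ := hasNbhs.Build kothe_space kothe_nbhs.

Let nbhs_filter (x : kothe_space) : ProperFilter (nbhs x).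
Proof.
split.
  move=> [S [e [_ SP e0]]] /(_ x); apply => p _.
  by rewrite subrr kothe_norm0.
split.
- by exists set0, 1; split=> //; exact: ltr01.
- move=> U V [S [e [fS SP e0 SU]]] [T [d [fT TP d0 TV]]].
  exists (S `|` T), (Num.min e d); split.
  + by rewrite finite_setU.
  + by move=> p [/SP|/TP].
  + by rewrite lt_min e0.
  + move=> y xy; split; [apply: SU|apply: TV] => p pS.
      by have := xy p (or_introl pS); rewrite lt_min => /andP[].
    by have := xy p (or_intror pS); rewrite lt_min => /andP[].
- move=> U V UV [S [e [fS SP e0 SU]]].
  by exists S, e; split=> //; exact: subset_trans SU UV.
Qed.

Let nbhs_singleton (x : kothe_space) (U : set kothe_space) : nbhs x U -> U x.
Proof.
by move=> [S [e [_ SP e0 SU]]]; apply: SU => p _; rewrite subrr kothe_norm0.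
Qed.

Lemma kothe_norm_distD p x y z : weights P p ->
  kothe_norm p (z - x) <= kothe_norm p (z - y) + kothe_norm p (y - x).
Proof.
move=> Pp; rewrite (_ : z - x = (z - y) + (y - x)) ?kothe_normD//.
by rewrite addrA subrK.
Qed.

Lemma kothe_norm_distC p x y : weights P p ->
  kothe_norm p (x - y) = kothe_norm p (y - x).
Proof. by move=> Pp; rewrite -kothe_normN// opprB. Qed.

Lemma finite_set_ubound (T : Type) (S : set T) (f : T -> R) : finite_set S ->
  exists2 M, 0 < M & forall t, S t -> f t < M.
Proof.
move=> fS; have [M SM] : exists M, forall t, S t -> f t <= M.
  have /finite_seqP[s sE] : finite_set (f @` S) by exact: finite_image.
  exists (\big[Num.max/0]_(r <- s) r) => t St.
  have : (f @` S) (f t) by exists t.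
  rewrite sE => fs; exact: (le_bigmax_seq 0 (f t) xpredT id fs).
exists (Num.max M 0 + 1).
  by rewrite ltr_wpDl// le_max lexx orbT.
move=> t /SM /le_lt_trans; apply.
by rewrite ltr_pwDr// le_max lexx.
Qed.

Lemma kothe_ball_open S (e : R) x : finite_set S -> S `<=` weights P ->
  forall y, kothe_ball S e x y -> nbhs y (kothe_ball S e x).
Proof.
move=> fS SP y xy.
have [M M0 MS] := finite_set_ubound (fun p => (e - kothe_norm p (y - x))^-1) fS.
exists S, M^-1; split; [exact: fS|exact: SP|by rewrite invr_gt0|].
move=> z yz p Sp; apply: le_lt_trans (kothe_norm_distD _ y _ (SP _ Sp)) _.
rewrite -ltrBrDr; apply: lt_trans (yz p Sp) _.
have e0 : 0 < e - kothe_norm p (y - x) by rewrite subr_gt0; exact: xy.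
rewrite -[ltRHS]invrK ltf_pV2 ?posrE ?invr_gt0//.
exact: MS.
Qed.

Let nbhs_nbhs (x : kothe_space) (U : set kothe_space) :
  nbhs x U -> nbhs x (nbhs^~ U).
Proof.
move=> [S [e [fS SP e0 SU]]]; exists S, e; split=> // y xy.
have [T [d [fT TP d0 TV]]] := kothe_ball_open fS SP xy.
by exists T, d; split=> //; exact: subset_trans TV SU.
Qed.

HB.instance Definition _ := Nbhs_isNbhsTopological.Build kothe_space
  nbhs_filter nbhs_singleton nbhs_nbhs.

Lemma nbhs_kothe (x : kothe_space) (U : set kothe_space) :
  nbhs x U <-> kothe_nbhs x U.
Proof. by []. Qed.

Lemma nbhs_kothe_ball (x : kothe_space) p (e : R) : weights P p -> 0 < e ->
  nbhs x (kothe_ball [set p] e x).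
Proof. by move=> Pp e0; exists [set p], e; split=> // _ ->. Qed.

Lemma nbhs_kothe_ballS (x : kothe_space) S (e : R) : finite_set S ->
  S `<=` weights P -> 0 < e -> nbhs x (kothe_ball S e x).
Proof. by move=> fS SP e0; exists S, e; split. Qed.

Let kothe_add_continuous :
  continuous (fun xy : kothe_space * kothe_space => xy.1 + xy.2).
Proof.
move=> [x y] U /= [S [e [fS SP e0 SU]]].
exists (kothe_ball S (e / 2) x, kothe_ball S (e / 2) y) => /=.
  by split; apply: nbhs_kothe_ballS; rewrite ?divr_gt0.
move=> [x' y'] /= [xx' yy']; apply: SU => p Sp /=.
rewrite opprD addrACA (splitr e).
apply: le_lt_trans (kothe_normD _ _ (SP _ Sp)) _.
by apply: ltrD; [exact: xx'|exact: yy'].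
Qed.

Lemma nbhs_normc (c : R[i]) (e : R) : 0 < e ->
  nbhs (c : R[i]^o) [set c' | normc (c' - c) < e].
Proof.
move=> e0; rewrite -nbhs_ballE; exists e%:C; first by rewrite /= ltcR.
move=> c'; rewrite -ball_normE /= distrC.
by rewrite -[`|_|]/((normc (c' - c))%:C) ltcR.
Qed.

Let kothe_scale_continuous :
  continuous (fun cx : R[i]^o * kothe_space => cx.1 *: cx.2).
Proof.
move=> [c x] U /= [S [e [fS SP e0 SU]]].
have [M M0 MS] := finite_set_ubound (fun p => kothe_norm p x) fS.
set K := normc c + 1.
have K0 : 0 < K by rewrite ltr_wpDl// normc_ge0.
set d := Num.min 1 (e / 2 / M).
have d0 : 0 < d by rewrite lt_min ltr01 !divr_gt0.
exists ([set c' | normc (c' - c) < d], kothe_ball S (e / 2 / K) x) => /=.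
  by split; [exact: nbhs_normc|apply: nbhs_kothe_ballS; rewrite ?divr_gt0].
move=> [c' x'] /= [cc' xx']; apply: SU => p Sp /=.
have Pp := SP _ Sp.
rewrite (_ : _ - _ = (c' *: (x' - x)) + (c' - c) *: x); last first.
  by rewrite scalerBr scalerBl addrA subrK.
apply: le_lt_trans (kothe_normD _ _ Pp) _; rewrite (splitr e).
have cK : normc c' <= K.
  rewrite -(subrK c c') (le_trans (le_normcD _ _))// addrC lerD2l.
  by apply/ltW/(lt_le_trans cc'); rewrite /d ge_min lexx.
apply: ltr_leD.
  apply: le_lt_trans (kothe_normZ _ _ Pp) _.
  apply: (@le_lt_trans _ _ (K * kothe_norm p (x' - x))).
    by rewrite ler_wpM2r// kothe_norm_ge0.
  by rewrite mulrC -ltr_pdivlMr//; exact: xx'.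
apply: le_trans (kothe_normZ _ _ Pp) _.
rewrite -[leRHS](@divfK _ M) ?gt_eqF//.
apply: ler_pM; rewrite ?normc_ge0 ?kothe_norm_ge0//; last exact/ltW/MS.
by apply/ltW/(lt_le_trans cc'); rewrite /d ge_min lexx orbT.
Qed.

Let kothe_locally_convex : exists2 B : set_system kothe_space,
  (forall b, b \in B -> convex_set b) & basis B.
Proof.
exists [set B | exists S (e : R) x, [/\ finite_set S, S `<=` weights P, 0 < e &
                                 B = kothe_ball S e x]].
  move=> B /[!inE] -[S [e [x [fS SP e0 ->]]]].
  move=> y z l /set_mem xy /set_mem xz; apply/mem_set => p Sp; have Pp := SP _ Sp.
  set t : R[i] := l%:num.
  pose r : R := complex.Re t.
  have t0 : 0 <= t by exact: (ge0 l).
  have t1 : t <= 1 by exact: (le1 l).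
  have tE : t = r%:C by rewrite /r RRe_real// ger0_real.
  have r0 : 0 <= r by rewrite -lecR -tE.
  have r1 : r <= 1 by rewrite -lecR -tE.
  rewrite (_ : _ - x = t *: (y - x) + (1 - t) *: (z - x)); last first.
    rewrite !scalerBr addrACA -opprD -scalerDl addrCA subrr addr0 scale1r.
    by [].
  have nr (s : R) : 0 <= s -> normc s%:C = s.
    by move=> s0; rewrite /normc/= expr0n addr0 sqrtr_sqr ger0_norm.
  apply: le_lt_trans (kothe_normD _ _ Pp) _.
  apply: (@le_lt_trans _ _ (r * kothe_norm p (y - x)
                            + (1 - r) * kothe_norm p (z - x))).
    apply: lerD; apply: le_trans (kothe_normZ _ _ Pp) _.
      by rewrite tE nr.
    by rewrite tE -(rmorph1 (real_complex R)) -rmorphB nr// subr_ge0.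
  have yl := xy p Sp; have zl := xz p Sp.
  have [->|rn0] := eqVneq r 0; first by rewrite mul0r subr0 mul1r add0r.
  rewrite -[ltRHS](_ : r * e + (1 - r) * e = _); last by rewrite -mulrDl addrC subrK mul1r.
  have r_gt0 : 0 < r by rewrite lt_neqAle eq_sym rn0.
  apply: ltr_leD; first by rewrite (ltr_pM2l r_gt0); exact: yl.
  by apply: ler_wpM2l; [rewrite subr_ge0|exact/ltW/zl].
split.
  move=> _ [S [e [x [fS SP e0 ->]]]].
  by rewrite openE => y; exact: kothe_ball_open.
move=> x U /= [S [e [fS SP e0 SU]]]; exists (kothe_ball S e x) => //=.
split; first by exists S, e, x; split.
by move=> p _; rewrite subrr kothe_norm0.
Qed.

HB.instance Definition _ := PreTopologicalLmod_isTvs.Build R[i] kothe_space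
  kothe_add_continuous kothe_scale_continuous kothe_locally_convex.

HB.instance Definition _ := PreTopologicalNmodule_isTopologicalNmodule.Build
  kothe_space kothe_add_continuous.
HB.instance Definition _ := TopologicalNmodule_isTopologicalLmodule.Build
  R[i] kothe_space kothe_scale_continuous.
HB.instance Definition _ := Uniform_isTvs.Build R[i] kothe_space
  kothe_locally_convex.

Let min_subadd (a b c w : R) : 0 <= b -> 0 <= c -> 0 < w -> a <= b + c ->
  Num.min a w <= Num.min b w + Num.min c w.
Proof.
move=> b0 c0 w0 abc; have := lerP c w; have := lerP b w.
case=> bw; case=> cw; rewrite ge_min.
- by rewrite abc.
- by rewrite lerDr b0 orbT.
- by rewrite lerDl c0 orbT.
- by rewrite lerDl (ltW w0) orbT.
Qed.

Lemma filter_finite_forall (T : Type) (J : eqType) (F : set_system T)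
    (S : set J) (Q : J -> set T) : Filter F -> finite_set S ->
  (forall j, S j -> F (Q j)) -> F [set t | forall j, S j -> Q j t].
Proof.
move=> FF /finite_seqP[s ->] FQ.
have {FQ}: forall j, j \in s -> F (Q j) by [].
elim: s => [|i s IH] FQ; first by apply: filterS (filterT : F setT) => t.
have FQs : forall j, j \in s -> F (Q j).
  by move=> j js; apply: FQ; rewrite inE js orbT.
have FQi : F (Q i) by apply: FQ; rewrite mem_head.
apply: filterS (filterI FQi (IH FQs)) => t [Qi Qs] j /=.
by rewrite inE => /orP[/eqP->//|js]; exact: (Qs j js).
Qed.

Lemma kothe_cvg (T : Type) (F : set_system T) (f : T -> kothe_space) l :
  Filter F ->
  (forall p (e : R), weights P p -> 0 < e -> F [set t | kothe_norm p (f t - l) < e]) ->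
  f t @[t --> F] --> l.
Proof.
move=> FF H U [S [e [fS SP e0 SU]]].
have := @filter_finite_forall T _ F S (fun p t => kothe_norm p (f t - l) < e) FF fS.
move=> /(_ (fun p Sp => H p e (SP p Sp) e0)).
by apply: (@filterS _ F) => t Ht; apply: SU => p Sp; exact: Ht.
Qed.

Lemma kothe_norm_eq0 x : (forall p, weights P p -> kothe_norm p x <= 0) -> x = 0.
Proof.
move=> x0; apply: val_inj; apply/funext => i /=.
have [p Pp pi] := kothe_gt0 P i.
apply: eq0_normc; apply/eqP; rewrite eq_le normc_ge0 andbT.
rewrite -(pmulr_lle0 _ pi) mulrC.
by rewrite mulrC (le_trans (kothe_coord _ _ Pp))// x0.
Qed.

Lemma kothe_metrizable : metrizable R kothe_space.
Proof.
have /countable_injP[f finj] := kothe_countable P.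
pose w p : R := (f p).+1%:R^-1.
have w0 p : 0 < w p by rewrite invr_gt0.
pose t p x y := Num.min (kothe_norm p (y - x)) (w p).
pose E x y := [set 0] `|` [set t p x y | p in weights P].
pose d x y := sup (E x y).
have t0 p x y : weights P p -> 0 <= t p x y.
  by move=> Pp; rewrite le_min kothe_norm_ge0//= ltW.
have Eub x y : has_ubound (E x y).
  exists 1 => _ [->|[p Pp <-]]; first exact: ler01.
  by rewrite ge_min; apply/orP; right; rewrite invf_le1// ler1n.
have td p x y : weights P p -> t p x y <= d x y.
  by move=> Pp; apply: ub_le_sup; [exact: Eub|right; exists p].
have d0 x y : 0 <= d x y by apply: ub_le_sup; [exact: Eub|left].
have dle x y r : 0 <= r -> (forall p, weights P p -> t p x y <= r) -> d x y <= r.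
  move=> r0 tr; apply: ge_sup; first by exists 0; left.
  by move=> _ [->|[p Pp <-]] //; exact: tr.
exists d; split.
- move=> x y; split=> [dxy|<-].
    apply/esym/eqP; rewrite -subr_eq0; apply/eqP/kothe_norm_eq0 => p Pp.
    have := td p x y Pp; rewrite dxy ge_min => /orP[//|].
    by rewrite leNgt w0.
  apply/eqP; rewrite eq_le d0 andbT; apply: dle => // p Pp.
  by rewrite ge_min subrr kothe_norm0 lexx.
- move=> x y; congr sup; apply/seteqP; rewrite /E /t.
  by split=> _ [->|[p Pp <-]]; [left|right; exists p|left|right; exists p];
    rewrite // kothe_norm_distC.
- move=> x y z; apply: dle => [|p Pp]; first exact: addr_ge0.
  apply: le_trans (lerD (td p x y Pp) (td p y z Pp)).
  rewrite addrC; apply: min_subadd; rewrite ?kothe_norm_ge0//.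
  exact: kothe_norm_distD.
- move=> x U; split.
    move=> [S [e [fS SP e0 SU]]].
    have [M M0 MS] := finite_set_ubound (fun p => (f p).+1%:R) fS.
    exists (Num.min e M^-1); first by rewrite lt_min e0 invr_gt0.
    move=> y /= dxy; apply: SU => p Sp; have := td p x y (SP _ Sp).
    move=> /le_lt_trans/(_ dxy); rewrite lt_min !gt_min => /andP[_ /orP[|]].
      move=> nM; have := td p x y (SP _ Sp); move=> /le_lt_trans/(_ dxy).
      rewrite lt_min !gt_min => /andP[/orP[//|we] _].
      apply: lt_trans nM _; apply: lt_trans we.
      by rewrite /w ltf_pV2 ?posrE//; exact: MS.
    by rewrite /w ltf_pV2 ?posrE// ltNge (ltW (MS _ Sp)).
  move=> [e e0 eU].
  have e20 : 0 < e / 2 by rewrite divr_gt0.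
  pose S := [set p | weights P p /\ e / 2 < w p].
  exists S, (e / 2); split; first 1 last.
  + by move=> p [].
  + by [].
  + move=> y xy; apply: eU => /=; apply: (@le_lt_trans _ _ (e / 2)).
      apply: dle => [|p Pp]; first exact: ltW.
      rewrite ge_min; have [we|we] := leP (w p) (e / 2); first by rewrite orbT.
      by rewrite ltW// xy.
    by rewrite ltr_pdivrMr// ltr_pMr// ltr1n.
  + have finjS : {in S &, injective f}.
      by move=> p q /set_mem[Pp _] /set_mem[Pq _]; apply: finj; exact/mem_set.
    rewrite -(eq_finite_set (inj_card_eq finjS)).
    apply: (@sub_finite_set _ _ `I_(Num.bound (e / 2)^-1)); last exact: finite_II.
    move=> _ [p [Pp we] <-] /=.
    have ub : (f p).+1%:R < (e / 2)^-1.
      by rewrite -[ltLHS]invrK ltf_pV2 ?posrE ?invr_gt0//; exact: w0.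
    have := lt_trans ub (archi_boundP (ltW (_ : 0 < (e / 2)^-1))).
    rewrite invr_gt0 => /(_ e20); rewrite ltr_nat.
    by move=> /ltnW.
Qed.

Lemma kothe_norm_sum p (x : kothe_space) (X : set I) : finite_set X ->
  weights P p ->
  \sum_(i <- finmap.enum_fset (fset_set X)) normc (x i) * p i <= kothe_norm p x.
Proof.
move=> fX Pp; rewrite -lee_fin kothe_normE//; apply: esum_ge.
by exists X; [split|rewrite fsbig_finite//= sumEFin].
Qed.

Let real_cauchy_cvg (F : set_system kothe_space) (u : kothe_space -> R) :
  ProperFilter F ->
  (forall e : R, 0 < e -> exists2 A, F A &
     forall x y, A x -> A y -> `|u x - u y| < e) ->
  exists l, forall e : R, 0 < e -> F [set x | `|u x - l| < e].
Proof.
move=> FF H.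
have : cvg (u x @[x --> F]).
  apply/cauchy_cvgP/cauchy_exP => e e0; have [A FA Ae] := H e e0.
  have [x Ax] := filter_ex FA; exists (u x); apply: (@filterS _ F _ A) FA => y Ay /=.
  by rewrite -ball_normE /=; exact: Ae.
move=> /cvg_ex[l ul]; exists l => e e0.
move/cvgrPdist_lt : ul => /(_ e e0); apply: filterS => x.
by rewrite distrC.
Qed.

Lemma Re_le_normc (z : R[i]) : `|complex.Re z| <= normc z.
Proof.
by case: z => a b /=; rewrite -sqrtr_sqr ler_wsqrtr// lerDl sqr_ge0.
Qed.

Lemma Im_le_normc (z : R[i]) : `|complex.Im z| <= normc z.
Proof.
by case: z => a b /=; rewrite -sqrtr_sqr ler_wsqrtr// lerDr sqr_ge0.
Qed.

Lemma normc_le_ReIm (z : R[i]) :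
  normc z <= `|complex.Re z| + `|complex.Im z|.
Proof.
case: z => a b /=; rewrite -[leRHS]ger0_norm ?addr_ge0// -sqrtr_sqr.
rewrite ler_wsqrtr// sqrrD !real_normK ?num_real// -addrA lerD2l.
by rewrite lerDr mulrn_wge0// mulr_ge0.
Qed.

Lemma kothe_complete : tvs_complete (kothe_space : tvsType R[i]).
Proof.
move=> F FF F0.
have cF p e : weights P p -> 0 < e -> exists2 A, F A &
    forall x y, A x -> A y -> kothe_norm p (x - y) < e.
  move=> Pp e0; have /F0 := nbhs_kothe_ball (0 : kothe_space) Pp e0.
  move=> [[A B] /= [FA FB] AB]; exists (A `&` B); first exact: filterI.
  move=> x y [Ax _] [_ By]; have := AB (x, y) (conj Ax By).
  by move=> /(_ p erefl); rewrite /= subr0.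
have /choice[l Fl] : forall i, exists c : R[i], forall e, 0 < e ->
    F [set x : kothe_space | normc (x i - c) < e].
  move=> i; have [p Pp pi] := kothe_gt0 P i.
  have H e : 0 < e -> exists2 A, F A &
      forall x y : kothe_space, A x -> A y -> normc (x i - y i) < e.
    move=> e0; have [|A FA Ae] := cF p (e * p i) Pp; first exact: mulr_gt0.
    exists A => // x y Ax Ay; rewrite -(ltr_pM2r pi).
    by apply: le_lt_trans (Ae x y Ax Ay); exact: (kothe_coord (x - y)).
  have [e e0|a Fa] := @real_cauchy_cvg F (fun x => complex.Re (x i)) FF.
    have [A FA Ae] := H e e0; exists A => // x y Ax Ay.
    rewrite -raddfB; apply: le_lt_trans (Re_le_normc _) _; exact: Ae.
  have [e e0|b Fb] := @real_cauchy_cvg F (fun x => complex.Im (x i)) FF.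
    have [A FA Ae] := H e e0; exists A => // x y Ax Ay.
    rewrite -raddfB; apply: le_lt_trans (Im_le_normc _) _; exact: Ae.
  exists (a +i* b) => e e0; have e20 : 0 < e / 2 by rewrite divr_gt0.
  apply: filterS (filterI (Fa _ e20) (Fb _ e20)) => x /= [xa xb].
  apply: le_lt_trans (normc_le_ReIm _) _; rewrite (splitr e) !raddfB /=.
  exact: ltrD.
have close p e (A : set kothe_space) : weights P p ->
    (forall x y, A x -> A y -> kothe_norm p (x - y) < e) -> F A ->
    forall x, A x -> (kothe_esum p ((x : I -> R[i]^o) - l)%R <= e%:E)%E.
  move=> Pp Ae FA x Ax; apply: ge_ereal_sup => _ [X [fX _] <-].
  rewrite fsbig_finite//= sumEFin lee_fin; apply/ler_addgt0Pr => d d0.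
  have Fs : forall (s : seq I) (d : R), 0 < d ->
      F [set y : kothe_space | \sum_(i <- s) normc (y i - l i) * p i < d].
    elim=> [|i s IH] {}d {}d0.
      by apply: filterS (filterT : F setT) => y _ /=; rewrite big_nil.
    have d20 : 0 < d / 2 by rewrite divr_gt0.
    have pi1 : 0 < p i + 1 by rewrite ltr_wpDl ?(kothe_ge0 Pp).
    apply: filterS (filterI (IH _ d20) (Fl i _ (divr_gt0 d20 pi1))) => y /=.
    move=> [ys yi]; rewrite big_cons (splitr d); apply: ler_ltD ys.
    apply: (@le_trans _ _ (normc (y i - l i) * (p i + 1))).
      by rewrite ler_wpM2l ?normc_ge0// lerDl.
    by rewrite -ler_pdivlMr// ltW.
  have [y [Ay yd]] := filter_ex (filterI FA (Fs (finmap.enum_fset (fset_set X)) d d0)).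
  apply: le_trans (lerD (ltW (Ae x y Ax Ay)) (ltW yd)).
  apply: le_trans (lerD (kothe_norm_sum (x - y) fX Pp) (lexx _)).
  rewrite -big_split /=; apply: ler_sum => i _; rewrite -mulrDl.
  rewrite ler_wpM2r ?(kothe_ge0 Pp)//.
  rewrite (_ : _ i = (x i - y i) + (y i - l i)) ?le_normcD//.
  by rewrite addrA subrK.
have lP : l \in in_kothe.
  apply/in_kotheP => p Pp; have [A FA Ae] := cF p 1 Pp ltr01.
  have [x Ax] := filter_ex FA.
  rewrite (_ : l = (x : I -> R[i]^o) + - 1 *: ((x : I -> R[i]^o) - l)); last first.
    by rewrite scaleN1r opprB addrC subrK.
  apply: le_lt_trans (kothe_esumD _ _ Pp) _; apply: lte_add_pinfty.
    by rewrite -kothe_normE// ltry.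
  apply: le_lt_trans (kothe_esumZ _ _ Pp) _.
  apply: lte_mul_pinfty; rewrite ?lee_fin ?normc_ge0//.
  by apply: le_lt_trans (close p 1 A Pp Ae FA x Ax) _; exact: ltry.
exists (KotheSpace lP) => U; apply: (@kothe_cvg _ F id) => p e Pp e0.
have e20 : 0 < e / 2 by rewrite divr_gt0.
have [A FA Ae] := cF p _ Pp e20.
apply: (@filterS _ F _ A _ _ FA) => x Ax /=.
rewrite -lte_fin kothe_normE//.
apply: le_lt_trans (close p _ A Pp Ae FA x Ax) _.
by rewrite lte_fin ltr_pdivrMr// ltr_pMr// ltr1n.
Qed.

Hypothesis kotheP : kothe_prec P (kothe_sq P).

Lemma kothe_mul_le p : weights P p -> exists q r (C : R),
  [/\ weights P q, weights P r, 0 < C & forall x y : kothe_space,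
    (kothe_esum p (x \* y)%R <=
      (C * kothe_norm q x * kothe_norm r y)%:E)%E].
Proof.
move=> /kotheP[_ [C [[q Pq] [r Pr] <- C0 pC]]].
exists q, r, C; split=> // x y; apply: ge_ereal_sup => _ [X [fX _] <-].
rewrite fsbig_finite//= sumEFin lee_fin.
rewrite mulrAC; apply: le_trans (ler_wpM2l _ (kothe_norm_sum x fX Pq)); last first.
  by rewrite mulr_ge0 ?kothe_norm_ge0// ltW.
rewrite mulr_sumr; apply: ler_sum => i _.
have qi := kothe_ge0 Pq i; have ri := kothe_ge0 Pr i.
apply: (@le_trans _ _ (normc (x i) * normc (y i) * (C * (q i * r i)))).
  rewrite -normcM ler_wpM2l ?normc_ge0//; exact: pC.
rewrite (_ : _ * _ * _ = C * (normc (y i) * r i) * (normc (x i) * q i)); last first.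
  by rewrite mulrCA -!mulrA; congr (_ * _); rewrite mulrCA; congr (_ * _); rewrite mulrC -!mulrA mulrC -mulrA.
rewrite ler_wpM2r ?mulr_ge0 ?normc_ge0//.
by rewrite ler_wpM2l ?(ltW C0)//; exact: kothe_coord.
Qed.

Lemma in_kothe_mul (x y : kothe_space) :
  ((x \* y : I -> R[i]^o) \in in_kothe).
Proof.
apply/in_kotheP => p /kothe_mul_le[q [r [C [_ _ _ /(_ x y)]]]].
by move=> /le_lt_trans; apply; exact: ltry.
Qed.

Definition kothe_mul (x y : kothe_space) : kothe_space :=
  KotheSpace (in_kothe_mul x y).

Let kothe_mulA : associative kothe_mul.
Proof. by move=> x y z; apply: val_inj; apply/funext => i /=; exact: mulrA. Qed.

Let kothe_mul_linearl y : linear (kothe_mul^~ y).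
Proof.
move=> c x x'; apply: val_inj; apply/funext => i /=.
by rewrite mulrDl -mulrA.
Qed.

Let kothe_mul_linearr x : linear (kothe_mul x).
Proof.
move=> c y y'; apply: val_inj; apply/funext => i /=.
by rewrite mulrDr mulrCA.
Qed.

Let kothe_mul_continuous :
  continuous (fun xy : kothe_space * kothe_space => kothe_mul xy.1 xy.2).
Proof.
move=> [x y]; apply: kothe_cvg => p e Pp e0 /=.
have [q [r [C [Pq Pr C0 H]]]] := kothe_mul_le Pp.
have Hn u v : kothe_norm p (kothe_mul u v) <=
    C * kothe_norm q u * kothe_norm r v.
  by rewrite -lee_fin kothe_normE//; exact: H.
set K := 1 + kothe_norm q x + kothe_norm r y.
have K0 : 0 < K by rewrite /K -addrA ltr_pwDl// addr_ge0// kothe_norm_ge0.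
set d := Num.min 1 (e / 2 / (C * K)).
have d0 : 0 < d by rewrite lt_min ltr01 !divr_gt0// mulr_gt0.
exists (kothe_ball [set q] d x, kothe_ball [set r] d y) => /=.
  by split; exact: nbhs_kothe_ball.
move=> [x' y'] /= [/(_ q erefl)/= xx' /(_ r erefl)/= yy'].
rewrite (_ : _ - _ = kothe_mul (x' - x) (y' - y) + kothe_mul (x' - x) y
                     + kothe_mul x (y' - y)); last first.
  apply: val_inj; apply/funext => i.
  rewrite -[LHS]/(x' i * y' i - x i * y i).
  rewrite -[RHS]/((x' i - x i) * (y' i - y i) + (x' i - x i) * y i
                  + x i * (y' i - y i)).
  by rewrite -mulrDr subrK mulrBl mulrBr addrA subrK.
apply: (@le_lt_trans _ _ (C * K * d)); last first.
  apply: (@le_lt_trans _ _ (e / 2)).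
    rewrite mulrC -ler_pdivlMr ?mulr_gt0//.
    by rewrite /d ge_min lexx orbT.
  by rewrite ltr_pdivrMr// ltr_pMr// ltr1n.
apply: le_trans (kothe_normD _ _ Pp) _.
apply: le_trans (lerD (kothe_normD _ _ Pp) (lexx _)) _.
apply: le_trans (lerD (lerD (Hn _ _) (Hn _ _)) (Hn _ _)) _.
rewrite -!mulrA -[X in X + _ <= _]mulrDr -mulrDr ler_wpM2l ?(ltW C0)//.
have dx := ltW xx'; have dy := ltW yy'.
rewrite /K !mulrDl mul1r [leRHS]addrAC; apply: lerD; last first.
  by apply: ler_wpM2l; first exact: kothe_norm_ge0.
apply: lerD; last by rewrite mulrC ler_wpM2l ?kothe_norm_ge0.
rewrite -[leRHS]mulr1; apply: ler_pM; rewrite ?kothe_norm_ge0//.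
by apply: le_trans dy _; rewrite /d ge_min lexx.
Qed.

Definition kothe_algebra : frechetAlgebra R := FrechetAlgebra
  (conj kothe_metrizable kothe_complete) kothe_mulA kothe_mul_linearl
  kothe_mul_linearr kothe_mul_continuous.

End KotheSpace.

(* Main.v *)
(** Let [e] be a finite sum of unit vectors of [A].  Because unit vectors are
    idempotents with [a * e_i = a_i e_i] for all [a], the elements
    [x = \sum e_i . D e_i] and [y = \sum D e_i . e_i] satisfy
    [a . x - x . a = e . D a] and [a . y - y . a = - D a . e], so that
    [x - y + e . y] implements the inner derivation
    [a |-> D a - (1 - e) . D a . (1 - e)].  Nuclearity and [P^2 < P] give square
    roots in [A], hence every [a] factors as [b * c], and
    [(1 - e) . D a . (1 - e) = (b - e b) . D c . (1 - e) + (1 - e) . D b . (c - e c)].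
    The norms of [e] are unbounded, so it is not enough that [b - e b -> 0]; but
    [e] can be chosen along with a scalar [k] such that both [k (b - e b)] and
    [k^-1 e] tend to [0], which is what the continuity of the actions requires. *)
Require Import Defs.
From HB Require Import structures.
From mathcomp Require Import all_boot all_order all_algebra.
From mathcomp Require Import complex.
From mathcomp Require Import all_classical all_reals all_analysis.

Import Order.TTheory GRing.Theory Num.Theory.
Import numFieldNormedType.Exports.

Local Open Scope classical_set_scope.
Local Open Scope ring_scope.

(** * Seminorm estimates and unit vectors in the Köthe space *)

Section KotheEstimates.
Set Implicit Arguments.
Unset Strict Implicit.
Import ComplexField.Normc.
Local Open Scope complex_scope.
Context {R : realType} {I : choiceType} (P : kotheSet R I).

Lemma normc_real (r : R) : 0 <= r -> normc r%:C = r.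
Proof. by move=> r0; rewrite /normc/= expr0n addr0 sqrtr_sqr ger0_norm. Qed.

Lemma kothe_esum_le (p q : I -> R) (x y : I -> R[i]^o) (K : R) :
  0 <= K -> (forall i, 0 <= q i) ->
  (forall i, normc (x i) * p i <= K * (normc (y i) * q i)) ->
  (kothe_esum p x <= K%:E * kothe_esum q y)%E.
Proof.
move=> K0 q0 xy; apply: le_trans (esumZl_le K0 _) => [|i].
  by apply: le_esum => i _; rewrite -EFinM lee_fin.
by rewrite lee_fin mulr_ge0 ?normc_ge0.
Qed.

Lemma kothe_norm_le {p q : I -> R} (x y : kothe_space P) (K : R) :
  weights P p -> weights P q -> 0 <= K ->
  (forall i, normc (x i) * p i <= K * (normc (y i) * q i)) ->
  kothe_norm p x <= K * kothe_norm q y.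
Proof.
move=> Pp Pq K0 xy; rewrite -lee_fin EFinM !kothe_normE//.
exact: (kothe_esum_le K0 (kothe_ge0 Pq)).
Qed.

Lemma kothe_norm_mono {p q : I -> R} (x : kothe_space P) :
  weights P p -> weights P q -> (forall i, p i <= q i) ->
  kothe_norm p x <= kothe_norm q x.
Proof.
move=> Pp Pq pq; have := @kothe_norm_le p q x x 1 Pp Pq ler01.
by rewrite mul1r; apply => i; rewrite mul1r ler_wpM2l ?normc_ge0.
Qed.

Lemma in_kothe_le (x : I -> R[i]^o) (y : kothe_space P) :
  (forall i, normc (x i) <= normc (y i)) -> x \in in_kothe P.
Proof.
move=> xy; apply/in_kotheP => p Pp.
apply: (@le_lt_trans _ _ (1%:E * kothe_esum p y)%E).
  apply: (kothe_esum_le ler01 (kothe_ge0 Pp)) => i.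
  by rewrite mul1r ler_wpM2r ?(kothe_ge0 Pp).
by rewrite mul1e -kothe_normE// ltry.
Qed.

Lemma in_kothe_unit (i : I) :
  ((fun j => (j == i)%:R) : I -> R[i]^o) \in in_kothe P.
Proof.
apply/in_kotheP => p Pp; rewrite /kothe_esum (@esumID _ _ [set i])//.
- rewrite setTI esum_set1; last by rewrite lee_fin mulr_ge0 ?normc_ge0 ?(kothe_ge0 Pp).
  rewrite [X in (_ + X)%E]esum1 ?adde0 ?ltry// => j [_ /= ji].
  by rewrite (negbTE (introN eqP ji)) [normc _](normc0 R) mul0r.
- by move=> j _; rewrite lee_fin mulr_ge0 ?normc_ge0 ?(kothe_ge0 Pp).
Qed.

Definition kothe_unit i : kothe_space P := KotheSpace (in_kothe_unit i).

Lemma kothe_unit_sumE (F : seq I) j :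
  uniq F -> (\sum_(i <- F) kothe_unit i) j = (j \in F)%:R.
Proof.
elim: F => [|i F IH]; first by rewrite big_nil.
rewrite big_cons /= inE => /andP[iF uF].
rewrite -[LHS]/((j == i)%:R + (\sum_(i <- F) kothe_unit i) j) IH//.
by case: eqVneq => [->|_]; rewrite ?(negbTE iF) ?addr0 ?add0r.
Qed.

(** * Products and roots of weights, from the equivalence of [P] and its square *)

Hypothesis sqP : kothe_prec (kothe_sq P) P.

Lemma kothe_weightM {p q : I -> R} : weights P p -> weights P q ->
  exists r (C : R), [/\ weights P r, 0 < C & forall i, p i * q i <= C * r i].
Proof. by move=> Pp Pq; apply: sqP; exists p => //; exists q. Qed.

Hypothesis Psq : kothe_prec P (kothe_sq P).

(** The two factors dominating [p] may differ; a common majorant from (P2) replaces both. *)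
Lemma kothe_weight_sqr {p : I -> R} : weights P p ->
  exists q (C : R), [/\ weights P q, 0 < C & forall i, p i <= C * q i ^+ 2].
Proof.
move=> /Psq[_ [C [[q Pq] [r Pr] <- C0 pC]]].
have [s Ps qrs] := kothe_max Pq Pr; exists s, C; split=> // i.
apply: le_trans (pC i) _; rewrite ler_wpM2l ?(ltW C0)//= expr2.
have := qrs i; rewrite ge_max => /andP[qs rs].
by rewrite ler_pM ?(kothe_ge0 Pq) ?(kothe_ge0 Pr).
Qed.

Lemma kothe_weight_pow4 {p : I -> R} : weights P p ->
  exists q (C : R), [/\ weights P q, 0 < C & forall i, p i <= C * q i ^+ 4].
Proof.
move=> /kothe_weight_sqr[q [C [Pq C0 pC]]].
have [r [D [Pr D0 qD]]] := kothe_weight_sqr Pq.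
exists r, (C * D ^+ 2); split=> // [|i]; first by rewrite mulr_gt0 ?exprn_gt0.
apply: le_trans (pC i) _; rewrite -mulrA ler_wpM2l ?(ltW C0)//.
rewrite -[4%N]/(2 * 2)%N exprM -exprMn.
apply: (lerXn2r 2); rewrite ?nnegrE ?(kothe_ge0 Pq)//.
by rewrite (le_trans (kothe_ge0 Pq i)).
Qed.

(** * Nuclearity: square roots, factorization and approximate units *)

Hypothesis nucP : forall p : I -> R, weights P p ->
  exists (q : I -> R) (alpha : I -> R),
    [/\ weights P q, summable [set: I] (fun i => (alpha i)%:E) &
        forall i : I, p i <= alpha i * q i].

(** Nuclearity trades summability for boundedness: with [p <= alpha * q] it suffices to bound
    [sqrt |x_i| * q_i], whose square [|x_i| * q_i ^ 2] is at most [C * |x_i| * r_i], hence at most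
    [C] times the [r]-norm of [x]. *)
Lemma in_kothe_sqrt (x : kothe_space P) :
  ((fun i => (Num.sqrt (normc (x i)))%:C) : I -> R[i]^o) \in in_kothe P.
Proof.
apply/in_kotheP => p Pp.
have [q [alpha [Pq salpha pq]]] := nucP Pp.
have [r [C [Pr C0 qr]]] := kothe_weightM Pq Pq.
set M := Num.sqrt (C * kothe_norm r x).
apply: (@le_lt_trans _ _ (M%:E * \esum_(i in [set: I]) `|(alpha i)%:E|)%E);
  last by apply: lte_mul_pinfty; rewrite ?lee_fin ?sqrtr_ge0.
apply: le_trans (esumZl_le _ _) => //; last exact: sqrtr_ge0.
apply: le_esum => i _; rewrite -EFinM lee_fin normc_real ?sqrtr_ge0//.
have qi := kothe_ge0 Pq i.
have H : Num.sqrt (normc (x i)) * q i <= M.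
  rewrite -{1}(ger0_norm qi) -sqrtr_sqr -sqrtrM ?normc_ge0// ler_wsqrtr//.
  apply: le_trans (ler_wpM2l (normc_ge0 _) (qr i)) _.
  by rewrite mulrCA ler_wpM2l ?(ltW C0)//; exact: kothe_coord.
apply: le_trans (ler_wpM2r (normr_ge0 _) H).
rewrite -mulrA ler_wpM2l ?sqrtr_ge0// mulrC.
by apply: le_trans (pq i) _; rewrite ler_wpM2r ?ler_norm.
Qed.

Definition kothe_sqrt x : kothe_space P := KotheSpace (in_kothe_sqrt x).

Lemma normc_kothe_sqrt x i : normc (kothe_sqrt x i) = Num.sqrt (normc (x i)).
Proof. exact/normc_real/sqrtr_ge0. Qed.

(** Take for [h] the sum of the fourth roots of [|x|] over [x] in [T]. Keeping [h] real and
    nonnegative makes moduli add exactly, so [h] dominates each summand. *)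
Lemma kothe_pow4_bound (T : seq (kothe_space P)) :
  exists2 h : kothe_space P, (forall i, h i = (normc (h i))%:C) &
    forall x i, x \in T -> normc (x i) <= normc (h i) ^+ 4.
Proof.
elim: T => [|x T [h hE hT]].
  by exists 0 => // i; rewrite [normc _](normc0 R).
set k := kothe_sqrt (kothe_sqrt x).
have kE i : k i = (normc (k i))%:C by rewrite normc_kothe_sqrt.
have hkE i : (h + k) i = (normc (h i) + normc (k i))%:C.
  by rewrite rmorphD /= -hE -kE.
have nhk i : normc ((h + k) i) = normc (h i) + normc (k i).
  by rewrite hkE normc_real ?addr_ge0 ?normc_ge0.
exists (h + k) => [i|y i]; first by rewrite nhk -hkE.
rewrite nhk inE => /orP[/eqP->|/(hT _ i)/le_trans]; last first.
  by apply; rewrite lerXn2r ?nnegrE ?lerDl ?addr_ge0 ?normc_ge0.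
apply: (@le_trans _ _ (normc (k i) ^+ 4)).
  rewrite !normc_kothe_sqrt -[4%N]/(2 * 2)%N exprM sqr_sqrtr ?sqrtr_ge0//.
  by rewrite sqr_sqrtr ?normc_ge0.
by rewrite lerXn2r ?nnegrE ?lerDr ?addr_ge0 ?normc_ge0.
Qed.

(** Markov's inequality for counting measure: [n] points of this set contribute more than [n * eps]
    to the [w]-norm of [h] once [n > 0]. *)
Lemma kothe_superlevel_finite (h : kothe_space P) (w : I -> R) (eps : R) :
  weights P w -> 0 < eps -> finite_set [set i | eps < normc (h i) * w i].
Proof.
move=> Pw eps0; apply: contrapT => /infinite_set_fset.
move=> /(_ (Num.bound (kothe_norm w h / eps)))[B BS cardB].
have := kothe_norm_sum h (finite_fset B) Pw; rewrite set_fsetK; apply/negP.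
rewrite -ltNge; apply: (@lt_le_trans _ _ (\sum_(i <- finmap.enum_fset B) eps)).
  rewrite big_const_seq count_predT iter_addr_0 -mulr_natr mulrC -ltr_pdivrMr//.
  apply: lt_le_trans (archi_boundP _) _; first by rewrite divr_ge0 ?kothe_norm_ge0// ltW.
  by rewrite ler_nat.
by rewrite big_seq [leRHS]big_seq; apply: ler_sum => i /BS/ltW.
Qed.

(* Off the superlevel set [F] of [h * s] at height [eps], where [b <= h ^ 4] and
   [q <= C * s ^ 4], the [q]-norm of [b] is [O(eps ^ 3)], while on [F] the
   [q]-norm of the unit is only [O(eps ^ -1)]; [t] is [eps ^ -2]. *)
Lemma kothe_approx_unit (T : seq (kothe_space P)) (q : I -> R) (d : R) :
  weights P q -> 0 < d -> exists (F : seq I) (k : R[i]),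
  let e := \sum_(i <- F) kothe_unit i in
  [/\ k != 0, kothe_norm q (k^-1 *: e) < d &
    forall b, b \in T ->
      kothe_norm q (b - kothe_mul Psq e b) < d /\
      kothe_norm q (k *: (b - kothe_mul Psq e b)) < d].
Proof.
move=> Pq d0; have [h _ hT] := kothe_pow4_bound T.
have [s [C [Ps C0 qs]]] := kothe_weight_pow4 Pq.
have [w [D [Pw D0 sqw]]] := kothe_weightM Ps Pq.
have hs0 := kothe_norm_ge0 h Ps; have hw0 := kothe_norm_ge0 h Pw.
(* The summand 1 makes [M] positive and the comparisons [CM] and [DM] strict. Below, [eps * M <= d]
   turns bounds of order [eps] into bounds by [d], and [eps <= 1] allows [eps ^ 3 <= eps]. *)
set M := C * kothe_norm s h + D * kothe_norm w h + 1.
have CM : C * kothe_norm s h < M.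
  by rewrite ltr_pwDr// lerDl mulr_ge0// ltW.
have DM : D * kothe_norm w h < M.
  by rewrite ltr_pwDr// lerDr mulr_ge0// ltW.
have M0 : 0 < M by apply: le_lt_trans CM; rewrite mulr_ge0// ltW.
set eps := Num.min 1 (d / M).
have eps0 : 0 < eps by rewrite lt_min ltr01 divr_gt0.
have eps1 : eps <= 1 by rewrite ge_min lexx.
have epsM : eps * M <= d by rewrite -ler_pdivlMr// ge_min lexx orbT.
have /finite_seqP[F0 F0E] := kothe_superlevel_finite h Ps eps0.
(* Without repetitions, the sum of unit vectors over [F] is the indicator of the superlevel set. *)
set F := undup F0; have uF : uniq F := undup_uniq _.
have FE i : (i \in F) = (eps < normc (h i) * s i).
  rewrite mem_undup; have : [set` F0] i = (eps < normc (h i) * s i) by rewrite -F0E.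
  by move=> E; apply/idP/idP; rewrite -E.
(* The scalar is [k = eps ^ -2], which balances the two estimates: [eps ^ 2 * eps ^ -1] and
   [eps ^ -2 * eps ^ 3] are both [eps]. *)
exists F, ((eps ^+ 2)^-1)%:C => e.
have eE i : e i = (i \in F)%:R := kothe_unit_sumE i uF.
have e_le : kothe_norm q e <= eps^-1 * D * kothe_norm w h.
  apply: kothe_norm_le => // [|i]; first by rewrite mulr_ge0 ?invr_ge0// ltW.
  have qi := kothe_ge0 Pq i.
  (* On [F] the factor [eps^-1 * |h_i| * s_i] exceeds 1, and [s * q <= D * w] returns to a single
     weight; off [F] the coordinate of [e] vanishes. *)
  rewrite eE FE; case: ltP => hi; last first.
    rewrite [normc _](normc0 R) mul0r mulr_ge0 ?(mulr_ge0 (normc_ge0 _)) ?(kothe_ge0 Pw)//.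
    by rewrite mulr_ge0 ?invr_ge0// ltW.
  rewrite [normc _](normc1 R) mul1r -mulrA ler_pdivlMl//.
  apply: (@le_trans _ _ (normc (h i) * s i * q i)); first by rewrite ler_wpM2r// ltW.
  by rewrite -mulrA [leRHS]mulrCA ler_wpM2l ?normc_ge0.
have b_le b : b \in T ->
    kothe_norm q (b - kothe_mul Psq e b) <= eps ^+ 3 * C * kothe_norm s h.
  move=> bT; apply: kothe_norm_le => // [|i]; first by rewrite mulr_ge0 ?exprn_ge0// ltW.
  have si := kothe_ge0 Ps i; have hi0 := normc_ge0 (h i).
  rewrite -[(b - _) i]/(b i - e i * b i) eE FE; case: ltP => hi.
    by rewrite mul1r subrr [normc _](normc0 R) mul0r !mulr_ge0 ?exprn_ge0// ltW.
  rewrite mul0r subr0.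
  apply: (@le_trans _ _ (normc (h i) ^+ 4 * (C * s i ^+ 4))).
    by rewrite ler_pM ?normc_ge0 ?(kothe_ge0 Pq)//; exact: hT.
  (* Of the four factors [|h_i| * s_i], three are bounded by the threshold [eps]; the last is kept
     to be summed. *)
  rewrite mulrCA -exprMn [eps ^+ 3 * C]mulrC -mulrA ler_wpM2l ?(ltW C0)//.
  rewrite exprSr ler_wpM2r ?mulr_ge0// lerXn2r ?nnegrE ?mulr_ge0//.
  exact: ltW.
have eps20 : 0 < eps ^+ 2 by rewrite exprn_gt0.
have kE : normc ((eps ^+ 2)^-1)%:C = (eps ^+ 2)^-1 by rewrite normc_real// invr_ge0 ltW.
split.
- by apply/eqP => k0; move: kE; rewrite k0 normc0 => /esym/eqP; rewrite invr_eq0 gt_eqF.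
- apply: le_lt_trans (kothe_normZ _ _ Pq) _; rewrite normcV kE invrK.
  apply: (@le_lt_trans _ _ (eps * (D * kothe_norm w h))); last first.
    by apply: lt_le_trans epsM; rewrite ltr_pM2l.
  apply: le_trans (ler_wpM2l (ltW eps20) e_le) _.
  by rewrite expr2 !mulrA mulfK ?gt_eqF.
- move=> b bT.
  have epsC : eps * (C * kothe_norm s h) < d.
    by apply: lt_le_trans epsM; rewrite ltr_pM2l.
  split.
    apply: le_lt_trans (b_le b bT) (le_lt_trans _ epsC).
    rewrite -mulrA ler_wpM2r ?mulr_ge0 ?(ltW C0)//.
    by rewrite -[leRHS]mulr1 exprS ler_wpM2l ?(ltW eps0)// exprn_ile1// ltW.
  apply: le_lt_trans (kothe_normZ _ _ Pq) _; rewrite kE.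
  apply: (@le_lt_trans _ _ (eps * (C * kothe_norm s h))) => //.
  apply: le_trans (ler_wpM2l _ (b_le b bT)) _; first by rewrite invr_ge0 ltW.
  by rewrite -mulrA (exprSr _ 2) -(mulrA (eps ^+ 2)) mulKf ?gt_eqF.
Qed.

Lemma kothe_mulC (x y : kothe_space P) : kothe_mul Psq x y = kothe_mul Psq y x.
Proof. by apply: val_inj; apply/funext => i; exact: mulrC. Qed.

Lemma kothe_mul_unit (x : kothe_space P) i :
  kothe_mul Psq x (kothe_unit i) = x i *: kothe_unit i.
Proof.
apply: val_inj; apply/funext => j; rewrite -[LHS]/(x j * (j == i)%:R).
rewrite -[RHS]/(x i * (j == i)%:R).
by case: eqVneq => [->|_] //; rewrite !mulr0.
Qed.

(** Take [y = sqrt |x|] and [z = x / y]. Then [|z| = |y|], also at the zeros of [x] because division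
    by 0 returns 0, so [z] lies in the space along with [y]. *)
Lemma kothe_factor (x : kothe_space P) : exists y z, x = kothe_mul Psq y z.
Proof.
set y := kothe_sqrt x.
have nz i : normc (x i / y i) = normc (y i).
  rewrite normcM normcV normc_kothe_sqrt; have [->|n0] := eqVneq (normc (x i)) 0.
    by rewrite mul0r sqrtr0.
  rewrite -{1}(sqr_sqrtr (normc_ge0 (x i))) expr2 mulfK//.
  by rewrite sqrtr_eq0 -ltNge lt_def n0 normc_ge0.
have zP : ((fun i => x i / y i) : I -> R[i]^o) \in in_kothe P.
  by apply: (@in_kothe_le _ y) => i; rewrite nz.
exists y, (KotheSpace zP); apply: val_inj; apply/funext => i.
rewrite -[RHS]/(y i * (x i / y i)) mulrC; have [y0|y0] := eqVneq (y i) 0; last by rewrite divfK.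
have : normc (y i) = 0 by rewrite y0 [normc _](normc0 R).
rewrite normc_kothe_sqrt => /eqP; rewrite sqrtr_eq0 => xi0.
rewrite y0 mulr0; apply: eq0_normc; apply/eqP.
by rewrite eq_le xi0 normc_ge0.
Qed.

(** The sets of pairs [(F, k)] that satisfy the estimates of [kothe_approx_unit] for given
    [(T, q, d)] form a filter base: that lemma makes them nonempty, and (P2) with concatenation of
    lists gives intersections. *)
Lemma kothe_approx_unit_filter :
  exists2 Phi : set_system (seq I * R[i]), ProperFilter Phi &
  [/\ Phi [set Fk | Fk.2 != 0],
      Fk.2^-1 *: (\sum_(i <- Fk.1) kothe_unit i) @[Fk --> Phi] --> (0 : kothe_space P),
      forall b : kothe_space P,
        b - kothe_mul Psq (\sum_(i <- Fk.1) kothe_unit i) b @[Fk --> Phi] --> (0 : kothe_space P) &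
      forall b : kothe_space P,
        Fk.2 *: (b - kothe_mul Psq (\sum_(i <- Fk.1) kothe_unit i) b) @[Fk --> Phi] --> (0 : kothe_space P)].
Proof.
(* Without weights the base would be empty; but then there is no seminorm to test, everything
   converges to 0, and any filter with [k = 1] serves. *)
have [[p0 Pp0]|noP] := pselect (exists p, weights P p); last first.
  exists (principal_filter ([::], 1)); first exact: principal_filter_proper.
  split; first exact/principal_filterP/oner_neq0.
  - by apply: kothe_cvg => p d Pp; case: noP; exists p.
  - by move=> b; apply: kothe_cvg => p d Pp; case: noP; exists p.
  - by move=> b; apply: kothe_cvg => p d Pp; case: noP; exists p.
pose e (Fk : seq I * R[i]) : kothe_space P := \sum_(i <- Fk.1) kothe_unit i.
pose dom : set (seq (kothe_space P) * (I -> R) * R) :=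
  [set Tqd | weights P Tqd.1.2 /\ 0 < Tqd.2].
pose B (Tqd : seq (kothe_space P) * (I -> R) * R) : set (seq I * R[i]) :=
  [set Fk | [/\ Fk.2 != 0, kothe_norm Tqd.1.2 (Fk.2^-1 *: e Fk) < Tqd.2 &
    forall b, b \in Tqd.1.1 ->
      kothe_norm Tqd.1.2 (b - kothe_mul Psq (e Fk) b) < Tqd.2 /\
      kothe_norm Tqd.1.2 (Fk.2 *: (b - kothe_mul Psq (e Fk) b)) < Tqd.2]].
have PhiB (T : seq (kothe_space P)) p d : weights P p -> 0 < d ->
    filter_from dom B (B (T, p, d)).
  by move=> Pp d0; exists (T, p, d).
have FPhi : ProperFilter (filter_from dom B).
  apply: filter_from_proper => [|[[T q] d] /= [Pq d0]]; last first.
    by have [F [k Fk]] := kothe_approx_unit T Pq d0; exists (F, k).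
  apply: filter_from_filter; first by exists ([::], p0, 1); split => /=.
  move=> [[T q] d] [[T' q'] d'] /= [Pq d0] /= [Pq' d0'].
  have [r Pr qr] := kothe_max Pq Pq'.
  have qr1 i : q i <= r i by have := qr i; rewrite ge_max => /andP[].
  have qr2 i : q' i <= r i by have := qr i; rewrite ge_max => /andP[].
  have lt1 (x : kothe_space P) : kothe_norm r x < Num.min d d' -> kothe_norm q x < d.
    rewrite lt_min => /andP[xd _].
    exact: le_lt_trans (kothe_norm_mono x Pq Pr qr1) xd.
  have lt2 (x : kothe_space P) : kothe_norm r x < Num.min d d' -> kothe_norm q' x < d'.
    rewrite lt_min => /andP[_ xd].
    exact: le_lt_trans (kothe_norm_mono x Pq' Pr qr2) xd.
  exists (T ++ T', r, Num.min d d'); first by split => //=; rewrite lt_min d0.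
  move=> Fk /= [k0 eFk bFk]; split; split => //=; [exact: lt1| |exact: lt2|].
    move=> b bT; have [|b1 b2] := bFk b; first by rewrite mem_cat bT.
    by split; exact: lt1.
  move=> b bT; have [|b1 b2] := bFk b; first by rewrite mem_cat bT orbT.
  by split; exact: lt2.
exists (filter_from dom B) => //; split.
- by apply: filterS (PhiB [::] p0 1 Pp0 ltr01) => Fk [].
- apply: kothe_cvg => p d Pp d0; apply: filterS (PhiB [::] p d Pp d0) => Fk.
  by move=> [_ + _]; rewrite /mkset subr0.
- move=> b; apply: kothe_cvg => p d Pp d0; apply: filterS (PhiB [:: b] p d Pp d0) => Fk.
  by move=> [_ _ /(_ b (mem_head _ _))[? ?]]; rewrite /mkset subr0.
- move=> b; apply: kothe_cvg => p d Pp d0; apply: filterS (PhiB [:: b] p d Pp d0) => Fk.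
  by move=> [_ _ /(_ b (mem_head _ _))[? ?]]; rewrite /mkset subr0.
Qed.

End KotheEstimates.

(** * Bilinear calculus and derivations in a Fréchet bimodule *)

Section Bimodules.
Set Implicit Arguments.
Unset Strict Implicit.
Context {R : realType} {A : frechetAlgebra R} {X : frechetBimodule A}.
Local Notation lact := (@fb_lact R A X).
Local Notation ract := (@fb_ract R A X).
Implicit Types (a b c : A) (x y : X) (k : R[i]).

Lemma lactBl a b x : lact (a - b) x = lact a x - lact b x.
Proof. exact: zmod_morphism_linear (fb_lact_linearl x) a b. Qed.

Lemma lactBr a x y : lact a (x - y) = lact a x - lact a y.
Proof. exact: zmod_morphism_linear (fb_lact_linearr a) x y. Qed.

Lemma ractBl x y a : ract (x - y) a = ract x a - ract y a.
Proof. exact: zmod_morphism_linear (fb_ract_linearl a) x y. Qed.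

Lemma ractBr x a b : ract x (a - b) = ract x a - ract x b.
Proof. exact: zmod_morphism_linear (fb_ract_linearr x) a b. Qed.

Lemma lactZl k a x : lact (k *: a) x = k *: lact a x.
Proof. exact: scalable_linear (fb_lact_linearl x) k a. Qed.

Lemma lactZr k a x : lact a (k *: x) = k *: lact a x.
Proof. exact: scalable_linear (fb_lact_linearr a) k x. Qed.

Lemma ractZl k x a : ract (k *: x) a = k *: ract x a.
Proof. exact: scalable_linear (fb_ract_linearl a) k x. Qed.

Lemma ractZr k x a : ract x (k *: a) = k *: ract x a.
Proof. exact: scalable_linear (fb_ract_linearr x) k a. Qed.

Lemma lact0l x : lact 0 x = 0.
Proof. by rewrite -[in LHS](subrr 0) lactBl subrr. Qed.

Lemma lact0r a : lact a 0 = 0.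
Proof. by rewrite -[in LHS](subrr 0) lactBr subrr. Qed.

Lemma ract0l a : ract 0 a = 0.
Proof. by rewrite -[in LHS](subrr 0) ractBl subrr. Qed.

Lemma ract0r x : ract x 0 = 0.
Proof. by rewrite -[in LHS](subrr 0) ractBr subrr. Qed.

Lemma lactDl a b x : lact (a + b) x = lact a x + lact b x.
Proof. by have := fb_lact_linearl x 1 a b; rewrite /= !scale1r. Qed.

Lemma lactDr a x y : lact a (x + y) = lact a x + lact a y.
Proof. by have := fb_lact_linearr a 1 x y; rewrite /= !scale1r. Qed.

Lemma ractDl x y a : ract (x + y) a = ract x a + ract y a.
Proof. by have := fb_ract_linearl a 1 x y; rewrite /= !scale1r. Qed.

Lemma ractDr x a b : ract x (a + b) = ract x a + ract x b.
Proof. by have := fb_ract_linearr x 1 a b; rewrite /= !scale1r. Qed.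

Definition commutator a x := lact a x - ract x a.

Lemma commutator0 a : commutator a 0 = 0.
Proof. by rewrite /commutator lact0r ract0l subrr. Qed.

Lemma commutatorD a x y : commutator a (x + y) = commutator a x + commutator a y.
Proof. by rewrite /commutator lactDr ractDl opprD addrACA. Qed.

Lemma commutatorB a x y : commutator a (x - y) = commutator a x - commutator a y.
Proof. by rewrite /commutator lactBr ractBl opprD addrACA -opprD. Qed.

Lemma commutator_lact e a x : fa_mul a e = fa_mul e a ->
  commutator a (lact e x) = lact e (commutator a x).
Proof. by move=> ae; rewrite /commutator lactBr -!fb_lactA ae fb_lractA. Qed.

Variables (D : A -> X) (derD : derivation D).

Lemma derivationM a b : D (fa_mul a b) = lact a (D b) + ract (D a) b.
Proof. by have [_] := derD. Qed.

Lemma derivationZ k a : D (k *: a) = k *: D a.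
Proof. by have [linD _] := derD; exact: scalable_linear linD k a. Qed.

(** * Inner derivations built from idempotents *)

Section OrthogonalIdempotents.
Variables (J : Type) (e : J -> A) (coef : A -> J -> R[i]).
Hypothesis eE : forall j, fa_mul (e j) (e j) = e j.
Hypothesis mul_er : forall a j, fa_mul a (e j) = coef a j *: e j.
Hypothesis mul_el : forall a j, fa_mul (e j) a = coef a j *: e j.

(** Expanding [D (e_j a) = coef a j *: D e_j] gives [D e_j . a = coef a j *: D e_j - e_j . D a].
    Multiplied by [e_j] and subtracted from [a e_j . D e_j], it loses its [coef] term and leaves
    [e_j . D a]. *)
Lemma inner_lact_idem (F : seq J) :
  exists x, forall a, commutator a x = lact (\sum_(j <- F) e j) (D a).
Proof.
elim: F => [|j F [x xF]].
  by exists 0 => a; rewrite commutator0 big_nil lact0l.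
exists (lact (e j) (D (e j)) + x) => a.
rewrite commutatorD xF big_cons lactDl; congr (_ + _).
rewrite /commutator -fb_lactA mul_er fb_lractA.
have -> : ract (D (e j)) a = coef a j *: D (e j) - lact (e j) (D a).
  by rewrite -derivationZ -mul_el derivationM addrC addKr.
by rewrite lactBr lactZl lactZr -fb_lactA eE subKr.
Qed.

Lemma inner_ract_idem (F : seq J) :
  exists x, forall a, commutator a x = - ract (D a) (\sum_(j <- F) e j).
Proof.
elim: F => [|j F [x xF]].
  by exists 0 => a; rewrite commutator0 big_nil ract0r oppr0.
exists (ract (D (e j)) (e j) + x) => a.
rewrite commutatorD xF big_cons ractDr opprD; congr (_ + _).
rewrite /commutator -fb_ractA mul_el -fb_lractA.
have -> : lact a (D (e j)) = coef a j *: D (e j) - ract (D a) (e j).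
  by rewrite -derivationZ -mul_er derivationM addrK.
by rewrite ractBl ractZl ractZr -fb_ractA eE addrAC subrr sub0r.
Qed.

(* The value is [D a - (1 - s) . D a . (1 - s)]. *)
Lemma inner_idem (F : seq J) (s := \sum_(j <- F) e j) :
  (forall a, fa_mul a s = fa_mul s a) ->
  exists x, forall a, commutator a x = lact s (D a) + ract (D a - lact s (D a)) s.
Proof.
move=> sC; have [x xF] := inner_lact_idem F; have [y yF] := inner_ract_idem F.
(* The commutator of [y] is [- D a . s]; as [s] commutes with [a], that of [s . y] is
   [- s . D a . s]. *)
exists (x - (y - lact s y)) => a.
rewrite !commutatorB (commutator_lact _ (sC a)) xF yF -/s ractBl fb_lractA.
rewrite -[- ract _ _]sub0r lactBr lact0r !sub0r opprD !opprK.
by [].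
Qed.

End OrthogonalIdempotents.

(** The subtracted term is [(1 - s) . D (b c) . (1 - s)] expanded by the Leibniz rule. Wherever a
    factor [s] remains outside the differences, it receives [k^-1] and the accompanying difference
    receives [k]; the scalars cancel by bilinearity. *)
Lemma derivation_defect a b c s (k : R[i]) : k != 0 -> a = fa_mul b c ->
  fa_mul c s = fa_mul s c ->
  lact s (D a) + ract (D a - lact s (D a)) s =
  D a - ((lact (b - fa_mul s b) (D c)
          - ract (lact (k *: (b - fa_mul s b)) (D c)) (k^-1 *: s))
         + (ract (D b) (c - fa_mul s c)
          - lact (k^-1 *: s) (ract (D b) (k *: (c - fa_mul s c))))).
Proof.
move=> k0 -> cs; rewrite derivationM.
have E1 u x : ract (lact (k *: u) x) (k^-1 *: s) = ract (lact u x) s.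
  by rewrite lactZl ractZl ractZr scalerA divff// scale1r.
have E2 u x : lact (k^-1 *: s) (ract x (k *: u)) = lact s (ract x u).
  by rewrite lactZl ractZr lactZr scalerA mulVf// scale1r.
have E3 : lact (b - fa_mul s b) (D c) = lact b (D c) - lact s (lact b (D c)).
  by rewrite lactBl fb_lactA.
have E4 : ract (D b) (c - fa_mul s c) = ract (D b) c - ract (ract (D b) c) s.
  by rewrite ractBr -cs fb_ractA.
rewrite E1 E2 E3 E4; set u := lact b _; set v := ract _ c.
rewrite !ractBl lactDr !ractDl !lactBr !fb_lractA.
rewrite (opprD (u - _ - _)) [u + v + _]addrACA.
rewrite -[u - _ - _]addrA -[v - _ - _]addrA -!opprD !subKr.
rewrite [ract v s + _]addrCA [RHS]addrACA; congr (_ + _).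
by rewrite opprD addrACA.
Qed.

(** * Passage to the limit in the compression formula *)

Section Convergence.
Variables (T : Type) (Phi : set_system T) (FPhi : Filter Phi).

Lemma cvg_lact (u : T -> A) (v : T -> X) a x : u @ Phi --> a -> v @ Phi --> x ->
  lact (u t) (v t) @[t --> Phi] --> lact a x.
Proof. exact: (continuous2_cvg _ (@fb_lact_continuous _ _ X (a, x))). Qed.

Lemma cvg_ract (u : T -> A) (v : T -> X) a x : v @ Phi --> x -> u @ Phi --> a ->
  ract (v t) (u t) @[t --> Phi] --> ract x a.
Proof. exact: (continuous2_cvg _ (@fb_ract_continuous _ _ X (x, a))). Qed.

Lemma cvg_tvsB (u v : T -> X) x y : u @ Phi --> x -> v @ Phi --> y ->
  u t - v t @[t --> Phi] --> x - y.
Proof.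
exact: (@continuous2_cvg _ _ _ _ _ _ u v (fun x y : X => x - y) x y (@sub_continuous X (x, y))).
Qed.

Lemma cvg_tvsD (u v : T -> X) x y : u @ Phi --> x -> v @ Phi --> y ->
  u t + v t @[t --> Phi] --> x + y.
Proof. exact: (@continuous2_cvg _ _ _ _ _ _ u v +%R x y (@add_continuous X (x, y))). Qed.

Lemma cvg_compression (s : T -> A) (k : T -> R[i]) b c :
  Phi [set t | k t != 0] ->
  (forall t a, fa_mul a (s t) = fa_mul (s t) a) ->
  (k t)^-1 *: s t @[t --> Phi] --> (0 : A) ->
  (forall a, a - fa_mul (s t) a @[t --> Phi] --> (0 : A)) ->
  (forall a, k t *: (a - fa_mul (s t) a) @[t --> Phi] --> (0 : A)) ->
  let d := D (fa_mul b c) in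
  lact (s t) d + ract (d - lact (s t) d) (s t) @[t --> Phi] --> d.
Proof.
move=> k0 sC s0 as0 kas0 d.
set l := (X in _ --> X).
(* The limit is written as the defect formula with every vanishing factor set to 0, so that joint
   continuity applies term by term. *)
have -> : l = d - ((lact 0 (D c) - ract (lact 0 (D c)) 0)
                   + (ract (D b) 0 - lact 0 (ract (D b) 0))).
  by rewrite !lact0l !ract0r !subr0 addr0 subr0.
have cst (x : X) : (fun=> x) @ Phi --> x by exact: cvg_cst.
move=> U lU.
have : Phi [set t | U (d - ((lact (b - fa_mul (s t) b) (D c)
          - ract (lact (k t *: (b - fa_mul (s t) b)) (D c)) ((k t)^-1 *: s t))
         + (ract (D b) (c - fa_mul (s t) c)
          - lact ((k t)^-1 *: s t) (ract (D b) (k t *: (c - fa_mul (s t) c))))))].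
  move: U lU; apply: cvg_tvsB; first exact: cst.
  apply: cvg_tvsD; apply: cvg_tvsB.
  - by apply: cvg_lact; [exact: as0|exact: cst].
  - by apply: cvg_ract => //; apply: cvg_lact; [exact: kas0|exact: cst].
  - by apply: cvg_ract; [exact: cst|exact: as0].
  - by apply: cvg_lact => //; apply: cvg_ract; [exact: cst|exact: kas0].
move=> dU; apply: (@filterS _ Phi _ _ _ _ (filterI k0 dU)) => t [kt].
by rewrite /mkset -(derivation_defect kt (erefl (fa_mul b c)) (sC t c)).
Qed.

End Convergence.

End Bimodules.

Lemma proper_filter_net {J : Type} {Phi : set_system J} : ProperFilter Phi ->
  exists (N : Type) (le : N -> N -> Prop) (f : N -> J),
    directed le /\ forall S, Phi S -> tails le (f @^-1` S).
Proof.
move=> FPhi; pose N := {Sj : set J * J | Phi Sj.1 /\ Sj.1 Sj.2}.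
have mkN S : Phi S -> exists n : N, (sval n).1 = S.
  move=> PhiS; have [j Sj] := filter_ex PhiS.
  by exists (exist _ (S, j) (conj PhiS Sj)).
exists N, (fun m n => (sval n).1 `<=` (sval m).1), (fun n => (sval n).2).
split; first split => //.
- by have [n _] := mkN _ filterT.
- by move=> n x.
- by move=> l m n ml nm x /nm /ml.
- move=> [[S i] [PhiS Si]] [[T j] [PhiT Tj]].
  have [n nE] := mkN _ (filterI PhiS PhiT); exists n.
  by rewrite nE; split => x [].
move=> S /mkN[n0 <-]; exists n0 => -[[T j] [PhiT Tj]] /=; exact.
Qed.

Theorem theorem7p1 (R : realType) (I : choiceType) (P : kotheSet R I)
    (hA : kothe_prec P (kothe_sq P))
    (hP : kothe_equiv P (kothe_sq P))
    (hN : forall p : I -> R, weights P p ->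
       exists (q : I -> R) (alpha : I -> R),
         [/\ weights P q, summable [set: I] (fun i => (alpha i)%:E) &
             forall i : I, p i <= alpha i * q i]) :
  approximately_contractible (kothe_algebra hA).
Proof.
move=> X D derD _; have [_ sqP] := hP.
set A := kothe_algebra hA in X D derD *.
have [Phi FPhi [Phi0 ecvg bcvg kbcvg]] := kothe_approx_unit_filter sqP hA hN.
pose e (Fk : seq I * R[i]) : A := \sum_(i <- Fk.1) kothe_unit P i.
have [N [le [f [dirN fN]]]] := proper_filter_net FPhi.
have ee i : @fa_mul _ A (kothe_unit P i) (kothe_unit P i) = kothe_unit P i.
  rewrite [LHS](kothe_mul_unit hA); rewrite -[LHS]/((i == i)%:R *: kothe_unit P i).
  by rewrite eqxx scale1r.
have ae (a : A) i : @fa_mul _ A a (kothe_unit P i) = (a : kothe_space P) i *: (kothe_unit P i : A).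
  exact: (kothe_mul_unit hA).
have ea (a : A) i : @fa_mul _ A (kothe_unit P i) a = (a : kothe_space P) i *: (kothe_unit P i : A).
  by rewrite -ae; exact: kothe_mulC.
have eC Fk (a : A) : @fa_mul _ A a (e Fk) = @fa_mul _ A (e Fk) a by exact: kothe_mulC.
have /choice[z zE] : forall Fk, exists x : X, forall a,
    commutator a x = fb_lact (e Fk) (D a) + fb_ract (D a - fb_lact (e Fk) (D a)) (e Fk).
  by move=> Fk; exact: (inner_idem derD ee ae ea (eC Fk)).
exists N, le, (fun n a => commutator a (z (f n))); split => // [n|a].
  by exists (z (f n)).
have [b [c ->]] : exists b c : A, a = fa_mul b c := kothe_factor sqP hA hN a.
move=> U DU; apply: (fN [set Fk | U (commutator (fa_mul b c) (z Fk))]).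
under eq_set do rewrite zE.
exact: (cvg_compression (b := b) (c := c) derD _ Phi0 eC ecvg bcvg kbcvg).
Qed.
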